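(* Let $n\ge 3$ be an integer, let $Z_n=\{0,1,\dots,n-1\}$, and let $t\in Z_n\setminus\{0\}$. If $t^2\equiv 1\pmod n$, then the groupoid $Z_n(t,1)$ (a member of $Z^{**}(n)$) is an AG-group.
   Context: A groupoid is a set with a binary operation. For $t,u\in Z_n$, $Z_n(t,u)$ denotes the groupoid on $Z_n=\{0,1,\dots,n-1\}$ with operation $a\cdot b = ta+ub \pmod n$. The class $Z^{**}(n)$ consists of the groupoids $Z_n(t,u)$ with $t,u\in Z_n\setminus\{0\}$ ($t,u$ not necessarily distinct or relatively prime). An AG-groupoid is a groupoid $G$ satisfying $(ab)c=(cb)a$ for all $a,b,c\in G$. An AG-group is an AG-groupoid $G$ with a left identity $e\in G$ (that is, $ea=a$ for all $a\in G$) such that for every $a\in G$ there exists $a^{-1}\in G$ with $a^{-1}a=aa^{-1}=e$. *)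

(* Defs.v *)
From mathcomp Require Import all_boot all_algebra.
Set Implicit Arguments.
Unset Strict Implicit.
Unset Printing Implicit Defensive.
Import GRing.Theory.
Local Open Scope ring_scope.

(* A groupoid is a carrier type T with a binary operation op : T -> T -> T. *)

Definition AG_groupoid (T : Type) (op : T -> T -> T) : Prop :=
  forall a b c : T, op (op a b) c = op (op c b) a.

Definition AG_group (T : Type) (op : T -> T -> T) : Prop :=
  AG_groupoid op /\
  exists e : T, left_id e op /\
    forall a : T, exists a' : T, op a' a = e /\ op a a' = e.

(* 'Z_n is the ring of integers mod n only for 1 < n. *)
Definition Zgroupoid (n : nat) (t u : 'Z_n) : 'Z_n -> 'Z_n -> 'Z_n :=
  fun a b => t * a + u * b.

Definition Zstarstar (n : nat) (op : 'Z_n -> 'Z_n -> 'Z_n) : Prop :=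
  exists t u : 'Z_n, [/\ t != 0, u != 0 & op = Zgroupoid t u].

(* Main.v *)
Require Import Defs.
From mathcomp Require Import all_boot all_algebra.
Import GRing.Theory.
Local Open Scope ring_scope.

(** Since [t * t = 1], the product [(a b) c = t (t a + b) + c] collapses to
    [a + t b + c], which is symmetric in [a] and [c]: this is the AG law.
    The coefficient [1] of the second argument makes [0] a left identity.
    An inverse [a'] of [a] must satisfy [t a + a' = 0], so [a' = - (t a)];
    then the other equation [t a' + a = 0] is again [t * t = 1].  Apart from
    this computation, carried out in [AG_group_involution], one only has to
    read the congruence [t ^ 2 = 1] as an equation in the ring of integers
    mod [n] ([Zp_sqr_eq1]). *)

Lemma Zp_sqr_eq1 (n : nat) (t : 'Z_n) :
  (1 < n)%N -> ((t : nat) ^ 2 = 1 %[mod n])%N -> t * t = 1.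
Proof.
move=> n_gt1 t2; rewrite -expr2 -[t]natr_Zp -natrX.
by rewrite -(Zp_nat_mod n_gt1) t2 (Zp_nat_mod n_gt1).
Qed.

Lemma AG_group_involution (n : nat) (t : 'Z_n) :
  t * t = 1 -> AG_group (Zgroupoid t 1).
Proof.
move=> tt; split=> [a b c|].
  rewrite /Zgroupoid !mul1r !mulrDr !mulrA tt !mul1r.
  by rewrite addrAC [RHS]addrAC (addrC a).
exists 0; split=> a; first by rewrite /Zgroupoid mulr0 add0r mul1r.
exists (- (t * a)); rewrite /Zgroupoid !mul1r subrr.
by rewrite mulrN mulrA tt mul1r addNr.
Qed.

Theorem theorem7 (n : nat) (hn : (3 <= n)%N) (t : 'Z_n) (ht : t != 0)
  (ht2 : ((t : nat) ^ 2 = 1 %[mod n])%N) :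
  Zstarstar (Zgroupoid t 1) /\ AG_group (Zgroupoid t 1).
Proof.
split; first by exists t, 1; split=> //; exact: oner_neq0.
by apply/AG_group_involution/Zp_sqr_eq1; first exact: ltnW.
Qed.
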